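(* Let $f$ be a $*$-identity of $M_{1,2}(F)$ of degree at most $3$. Then $f$ belongs to the $T_2^*$-ideal of the free $*$-superalgebra generated by the set $\mathcal{I}$ consisting of the $*$-polynomials $[y_1^+,y_2^+]$, $[y_1^+,y_1^-]$, $y_1^-z_1^+y_2^-$, $y_1^-z_1^-y_2^-$, $z_1^+z_2^+z_3^++z_2^+z_3^+z_1^++z_3^+z_1^+z_2^+$, $z_1^-z_2^-z_3^-+z_2^-z_3^-z_1^-+z_3^-z_1^-z_2^-$, $z_1^+y_1^-z_2^+-z_2^+y_1^-z_1^+$, $z_1^-y_1^-z_2^--z_2^-y_1^-z_1^-$, $z_1^+z_2^+z_1^--z_2^+z_1^-z_1^++z_1^-z_1^+z_2^+$, $z_1^-z_2^-z_1^+-z_2^-z_1^+z_1^-+z_1^+z_1^-z_2^-$, $z_1^+y_1^-z_1^-+z_1^-y_1^-z_1^+$.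
   Context: $F$ is a field of characteristic zero. $M_{1,2}(F)$ is the algebra of $3\times 3$ matrices over $F$ with $\mathbb{Z}_2$-grading whose even part is spanned by $e_{11},e_{22},e_{23},e_{32},e_{33}$ and odd part by $e_{12},e_{13},e_{21},e_{31}$, with the orthosymplectic superinvolution $*$ sending the matrix with rows $(a,b,c),(d,e,f),(g,h,i)$ to the matrix with rows $(a,-g,d),(c,i,-f),(-b,-h,e)$ (a superinvolution is a grading-preserving linear map with $(a^* )^*=a$ and $(ab)^*=(-1)^{|a||b|}b^*a^*$). The free $*$-superalgebra is the free associative algebra on variables $y_i^+$ (even, symmetric), $y_i^-$ (even, skew), $z_i^+$ (odd, symmetric), $z_i^-$ (odd, skew), $i\ge 1$, with the grading and the superinvolution determined by these labels. A $*$-polynomial is a $*$-identity of $M_{1,2}(F)$ if it vanishes under every substitution of $y_i^+,y_i^-,z_i^+,z_i^-$ by elements of the even symmetric, even skew, odd symmetric, odd skew parts of $M_{1,2}(F)$, respectively. A $T_2^*$-ideal is an ideal of the free $*$-superalgebra invariant under all grading-preserving endomorphisms commuting with the superinvolution. $[a,b]=ab-ba$. *)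

(* Defs.v *)
From HB Require Import structures.
From mathcomp Require Import all_boot all_order all_algebra.
From Stdlib Require List.
Set Implicit Arguments. Unset Strict Implicit. Unset Printing Implicit Defensive.
Import Order.TTheory GRing.Theory Num.Theory.
Local Open Scope ring_scope.

(* Variables of the free *-superalgebra: (odd, skew, index).
   (false,false,i) = y_i^+ (even symmetric), (false,true,i) = y_i^- (even skew),
   (true,false,i)  = z_i^+ (odd symmetric),  (true,true,i)  = z_i^- (odd skew). *)
Definition var := (bool * bool * nat)%type.
Definition var_odd (v : var) : bool := v.1.1.
Definition var_skew (v : var) : bool := v.1.2.

Section FreeStarSuperalgebra.
Variable F : fieldType.

Inductive term : Type :=
| Var of var
| Cst of F
| Add of term & term
| Mul of term & term.

(* Coefficient of the monomial (word) w in a term: identifies a term with the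
   element of the free associative algebra F<X> it denotes. *)
Fixpoint coef (p : term) (w : seq var) : F :=
  match p with
  | Var v => (w == [:: v])%:R
  | Cst c => c *+ (w == [::])
  | Add p q => coef p w + coef q w
  | Mul p q => \sum_(i < (size w).+1) coef p (take i w) * coef q (drop i w)
  end.

(* Superinvolution of F<X> at the level of coefficient functions:
   (x_1...x_n)^* = (-1)^{sum_{i<j}|x_i||x_j|} x_n^* ... x_1^*, x^* = +-x. *)
Definition nodd (w : seq var) : nat := count var_odd w.
Definition koszul (w : seq var) : F := (-1) ^+ 'C(nodd w, 2).
Definition epsw (w : seq var) : F := (-1) ^+ count var_skew w.
Definition starc (f : seq var -> F) (w : seq var) : F :=
  koszul w * epsw w * f (rev w).

Fixpoint subst (s : var -> term) (p : term) : term :=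
  match p with
  | Var v => s v
  | Cst c => Cst c
  | Add p q => Add (subst s p) (subst s q)
  | Mul p q => Mul (subst s p) (subst s q)
  end.

(* The endomorphism given by s preserves the grading and commutes with *:
   each s v is homogeneous of the parity of v and is symmetric/skew like v. *)
Definition admissible (s : var -> term) : Prop :=
  forall v : var,
    (forall w, coef (s v) w != 0 -> odd (nodd w) = var_odd v) /\
    (forall w, starc (coef (s v)) w = (if var_skew v then -1 else 1) * coef (s v) w).

Inductive in_TI (I : term -> Prop) : term -> Prop :=
| TI_gen g : I g -> in_TI I g
| TI_zero : in_TI I (Cst 0)
| TI_add p q : in_TI I p -> in_TI I q -> in_TI I (Add p q)
| TI_mull a p : in_TI I p -> in_TI I (Mul a p)
| TI_mulr p a : in_TI I p -> in_TI I (Mul p a)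
| TI_subst s p : admissible s -> in_TI I p -> in_TI I (subst s p)
| TI_eq p q : (forall w, coef p w = coef q w) -> in_TI I p -> in_TI I q.

(* The superalgebra M_{1,2}(F) with the orthosymplectic superinvolution. *)
Definition ostar (A : 'M[F]_3) : 'M[F]_3 :=
  \matrix_(i < 3, j < 3)
    match nat_of_ord i, nat_of_ord j with
    | 0, 0 => A 0 0 | 0, 1 => - A 2 0 | 0, _ => A 1 0
    | 1, 0 => A 0 2 | 1, 1 => A 2 2   | 1, _ => - A 1 2
    | _, 0 => - A 0 1 | _, 1 => - A 2 1 | _, _ => A 1 1
    end.

Definition oddpos (i j : 'I_3) : bool :=
  ((nat_of_ord i == 0%N) && (nat_of_ord j != 0%N)) ||
  ((nat_of_ord i != 0%N) && (nat_of_ord j == 0%N)).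

Definition homog (b : bool) (A : 'M[F]_3) : Prop :=
  forall i j : 'I_3, oddpos i j != b -> A i j = 0.

Fixpoint eval (e : var -> 'M[F]_3) (p : term) : 'M[F]_3 :=
  match p with
  | Var v => e v
  | Cst c => c%:M
  | Add p q => eval e p + eval e q
  | Mul p q => eval e p *m eval e q
  end.

Definition admissible_eval (e : var -> 'M[F]_3) : Prop :=
  forall v : var, homog (var_odd v) (e v) /\
    ostar (e v) = (if var_skew v then - e v else e v).

Definition star_identity (f : term) : Prop :=
  forall e, admissible_eval e -> eval e f = 0.

Definition degree_le (f : term) (n : nat) : Prop :=
  forall w, coef f w != 0 -> (size w <= n)%N.

Definition yp i := Var (false, false, i).
Definition ym i := Var (false, true, i).
Definition zp i := Var (true, false, i).
Definition zm i := Var (true, true, i).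
Definition neg (p : term) := Mul (Cst (-1)) p.
Definition comm (a b : term) := Add (Mul a b) (neg (Mul b a)).
Definition M3 (a b c : term) := Mul (Mul a b) c.

Definition gens : list term :=
  [:: comm (yp 1) (yp 2);
      comm (yp 1) (ym 1);
      M3 (ym 1) (zp 1) (ym 2);
      M3 (ym 1) (zm 1) (ym 2);
      Add (Add (M3 (zp 1) (zp 2) (zp 3)) (M3 (zp 2) (zp 3) (zp 1))) (M3 (zp 3) (zp 1) (zp 2));
      Add (Add (M3 (zm 1) (zm 2) (zm 3)) (M3 (zm 2) (zm 3) (zm 1))) (M3 (zm 3) (zm 1) (zm 2));
      Add (M3 (zp 1) (ym 1) (zp 2)) (neg (M3 (zp 2) (ym 1) (zp 1)));
      Add (M3 (zm 1) (ym 1) (zm 2)) (neg (M3 (zm 2) (ym 1) (zm 1)));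
      Add (Add (M3 (zp 1) (zp 2) (zm 1)) (neg (M3 (zp 2) (zm 1) (zp 1)))) (M3 (zm 1) (zp 1) (zp 2));
      Add (Add (M3 (zm 1) (zm 2) (zp 1)) (neg (M3 (zm 2) (zp 1) (zm 1)))) (M3 (zp 1) (zm 1) (zm 2));
      Add (M3 (zp 1) (ym 1) (zm 1)) (M3 (zm 1) (ym 1) (zp 1))].

Definition calI (g : term) : Prop := List.In g gens.

End FreeStarSuperalgebra.

(* Main.v *)
(* A *-identity f of degree at most 3 splits into homogeneous components, each again a
   *-identity (evaluate at 0, e, -e and 2e). In characteristic 0 the component of degree 3 is
   1/6 of the sum, over all triples of variables (x, y, z), of the multilinear elements
     c1 xyz + c2 xzy + c3 yxz + c4 yzx + c5 zxy + c6 zyx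
   formed from its coefficients. By polarization each of these vanishes when x, y, z are
   replaced by arbitrary matrices of the corresponding types. Evaluating at a few matrices with
   entries 0, 1, -1 gives, for each triple of types, enough linear equations on the ci to write
   the element as an explicit combination of consequences of the generators: their products
   with a variable, and the commutators [y, ab + ba] and [y, ab - ba] with a, b of equal
   parity. In degree less than 3 the missing variables are replaced by 1. *)
Require Import Defs.
From HB Require Import structures.
From mathcomp Require Import all_boot all_order all_algebra.
From mathcomp Require Import ring.
Set Implicit Arguments. Unset Strict Implicit. Unset Printing Implicit Defensive.
Import GRing.Theory.
Local Open Scope ring_scope.

Section LowDegreeIdentities.
Variable F : fieldType.
Hypothesis charF0 : [pchar F] =i pred0.
Implicit Types (p q : term F) (u v w : seq var) (x y z : var) (A B C : 'M[F]_3).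

(** * Characteristic zero and cubic polynomials *)

Lemma natr_neq0 n : n.+1%:R != 0 :> F.
Proof. by have /pcharf0P-> := charF0. Qed.

Lemma cubic_eq0 (a b c d : F) :
  (forall t : F, a + t * b + t ^+ 2 * c + t ^+ 3 * d = 0) -> [/\ a = 0, b = 0, c = 0 & d = 0].
Proof.
move=> E; have n2 : 2 != 0 :> F := natr_neq0 1; have n3 : 3 != 0 :> F := natr_neq0 2.
have a0 : a = 0 by rewrite -(E 0); ring.
have c0 : c = 0.
  by apply: (mulfI n2); rewrite mulr0 -[RHS](addr0 0) -{1}(E 1) -(E (-1)) a0; ring.
have d0 : d = 0.
  (* Once a and c vanish, the value at 2 minus twice the value at 1 is 6 d. *)
  apply: (mulfI n2); apply: (mulfI n3).
  by rewrite !mulr0 -[RHS](subr0 0) -{1}(E 2) -(mulr0 2) -(E 1) a0 c0; ring.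
by split=> //; rewrite -(E 1) a0 c0 d0; ring.
Qed.

(** * Terms as linear combinations of words *)

Fixpoint flat p : seq (F * seq var) :=
  match p with
  | Var x => [:: (1, [:: x])]
  | Cst c => [:: (c, [::])]
  | Add p q => flat p ++ flat q
  | Mul p q => [seq (a.1 * b.1, a.2 ++ b.2) | a <- flat p, b <- flat q]
  end.

Definition mon u w : F := (w == u)%:R.

Lemma mon_nil : mon [::] [::] = 1.
Proof. by []. Qed.

Lemma mon_cons x u y w : mon (x :: u) (y :: w) = (y == x)%:R * mon u w.
Proof. by rewrite /mon eqseq_cons -mulnb natrM. Qed.

Lemma mon_size u w : size w != size u -> mon u w = 0.
Proof. by rewrite /mon; have [->|//] := eqVneq w u; rewrite eqxx. Qed.

(** Only the cut after [size u] letters can contribute, and it does not exist if [w] is shorter than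
    [u]. So the convolution in [coef] matches concatenation of words. *)
Lemma mon_cat u v w :
  \sum_(i < (size w).+1) mon u (take i w) * mon v (drop i w) = mon (u ++ v) w.
Proof.
have term0 i : (i < (size w).+1)%N -> i != size u ->
    mon u (take i w) * mon v (drop i w) = 0.
  move=> lei ne; rewrite /mon; case: eqP => [E|]; last by rewrite mul0r.
  by move: ne; rewrite -E size_takel // eqxx.
have [lt_uw|ge_uw] := ltnP (size u) (size w).+1.
  rewrite (bigD1 (Ordinal lt_uw)) //= big1 ?addr0 => [|i ne]; last first.
    by rewrite term0.
  by rewrite /mon -natrM mulnb -{3}(cat_take_drop (size u) w) eqseq_cat ?size_takel.
rewrite big1 => [|i _]; last by rewrite term0 // neq_ltn (leq_trans (ltn_ord i) ge_uw).
by rewrite /mon; case: eqP => // E; move: ge_uw; rewrite E size_cat ltnNge leq_addr.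
Qed.

Lemma coef_flat p w : coef p w = \sum_(m <- flat p) m.1 * mon m.2 w.
Proof.
elim: p w => [x|c|p IHp q IHq|p IHp q IHq] w /=.
- by rewrite big_seq1 mul1r.
- by rewrite big_seq1 /mon mulr_natr.
- by rewrite big_cat /= IHp IHq.
rewrite big_allpairs_dep /=.
under eq_bigr do rewrite IHp IHq big_distrlr /=.
rewrite exchange_big; apply: eq_bigr => a _.
rewrite exchange_big; apply: eq_bigr => b _.
by rewrite -mon_cat big_distrr /=; apply: eq_bigr => i _; rewrite mulrACA.
Qed.

Definition eprod (e : var -> 'M[F]_3) w : 'M[F]_3 :=
  foldr (fun x A => e x *m A) 1%:M w.

Lemma eprod_cat e u v : eprod e (u ++ v) = eprod e u *m eprod e v.
Proof. by elim: u => [|x u /= ->]; rewrite ?mul1mx ?mulmxA. Qed.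

Lemma eval_flat e p : eval e p = \sum_(m <- flat p) m.1 *: eprod e m.2.
Proof.
elim: p => [x|c|p IHp q IHq|p IHp q IHq] /=.
- by rewrite big_seq1 scale1r /= mulmx1.
- by rewrite big_seq1 /= scalemx1.
- by rewrite big_cat /= IHp IHq.
rewrite big_allpairs_dep IHp IHq mulmx_suml; apply: eq_bigr => a _.
rewrite mulmx_sumr; apply: eq_bigr => b _ /=.
by rewrite eprod_cat -scalemxAl -scalemxAr scalerA.
Qed.

(** A finite list containing the support of [coef p]; words whose coefficients cancel may stay in
    it. *)
Definition words_of p : seq (seq var) := undup [seq m.2 | m <- flat p].

Lemma coef_words_of p w : w \notin words_of p -> coef p w = 0.
Proof.
rewrite mem_undup => wN; rewrite coef_flat big_seq big1 // => m mf.
rewrite /mon; case: eqP => [E|]; last by rewrite mulr0.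
by move: wN; rewrite E map_f.
Qed.

Lemma sum_mon (V : lmodType F) p (P : pred (seq var)) u (A : V) :
  P u -> \sum_(w <- words_of p | P w) coef p w *: (mon u w *: A) = coef p u *: A.
Proof.
move=> Pu; have [us|uN] := boolP (u \in words_of p); last first.
  rewrite (coef_words_of uN) scale0r big_seq_cond big1 // => w /andP[ws _].
  rewrite /mon; case: eqP => [E|]; last by rewrite scale0r scaler0.
  by move: uN; rewrite -E ws.
rewrite big_mkcond (bigD1_seq u) ?undup_uniq //= Pu /mon eqxx scale1r.
rewrite big1 ?addr0 // => w /negPf ->.
by rewrite scale0r scaler0 if_same.
Qed.

Lemma eval_words_of e p : eval e p = \sum_(w <- words_of p) coef p w *: eprod e w.
Proof.
rewrite eval_flat; under [RHS]eq_bigr do rewrite coef_flat scaler_suml.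
rewrite exchange_big /= !big_seq; apply: eq_bigr => m mf.
rewrite (bigD1_seq m.2) ?undup_uniq ?mem_undup ?map_f //=.
rewrite /mon eqxx mulr1 big1 ?addr0 // => w /negPf ->.
by rewrite mulr0 scale0r.
Qed.

(** * Matrices of a given type and polarization *)

(** The six permutations are in lexicographic order, here as in [word6] and [comb_term]. *)
Definition comb6 (c1 c2 c3 c4 c5 c6 : F) A B C : 'M[F]_3 :=
  c1 *: (A *m B *m C) + c2 *: (A *m C *m B) + c3 *: (B *m A *m C)
  + c4 *: (B *m C *m A) + c5 *: (C *m A *m B) + c6 *: (C *m B *m A).

(** [t] is the pair (odd, skew), so [admissible_eval e] says that each [e x] has type [x.1]. *)
Definition of_type (t : bool * bool) A : Prop :=
  homog t.1 A /\ ostar A = (if t.2 then - A else A).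

Lemma ostarD A B : ostar (A + B) = ostar A + ostar B.
Proof.
by apply/matrixP=> -[[|[|[|//]]] ?] [[|[|[|//]]] ?]; rewrite !mxE //= opprD.
Qed.

Lemma ostarZ (a : F) A : ostar (a *: A) = a *: ostar A.
Proof.
by apply/matrixP=> -[[|[|[|//]]] ?] [[|[|[|//]]] ?]; rewrite !mxE //= mulrN.
Qed.

Lemma of_typeD t A B : of_type t A -> of_type t B -> of_type t (A + B).
Proof.
move=> [hA sA] [hB sB]; split=> [i j ij|]; first by rewrite mxE hA // hB // addr0.
by rewrite ostarD sA sB; case: t.2; rewrite ?opprD.
Qed.

Lemma of_typeZ t (a : F) A : of_type t A -> of_type t (a *: A).
Proof.
move=> [hA sA]; split=> [i j ij|]; first by rewrite mxE hA // mulr0.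
by rewrite ostarZ sA; case: t.2; rewrite ?scalerN.
Qed.

Lemma of_type0 t : of_type t 0.
Proof.
split=> [i j _|]; first by rewrite mxE.
by rewrite -(scale0r 0) ostarZ !scale0r oppr0 if_same.
Qed.

Lemma polarize2 (X1 X2 Y1 Y2 : 'M[F]_3) :
  (X1 + X2) *m (Y1 + Y2) - X1 *m Y1 - X2 *m Y2 = X1 *m Y2 + X2 *m Y1.
Proof.
rewrite !mulmxDl !mulmxDr.
move: (X1 *m Y1) (X1 *m Y2) (X2 *m Y1) (X2 *m Y2) => P Q R S.
by apply/matrixP => i j; rewrite !mxE; ring.
Qed.

(** Inclusion-exclusion over the nonempty sets of indices: products that miss an index cancel. *)
Lemma polarize3 (X1 X2 X3 Y1 Y2 Y3 Z1 Z2 Z3 : 'M[F]_3) :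
  (X1 + X2 + X3) *m ((Y1 + Y2 + Y3) *m (Z1 + Z2 + Z3))
  - (X1 + X2) *m ((Y1 + Y2) *m (Z1 + Z2))
  - (X1 + X3) *m ((Y1 + Y3) *m (Z1 + Z3))
  - (X2 + X3) *m ((Y2 + Y3) *m (Z2 + Z3))
  + X1 *m (Y1 *m Z1) + X2 *m (Y2 *m Z2) + X3 *m (Y3 *m Z3)
  = X1 *m (Y2 *m Z3) + X1 *m (Y3 *m Z2) + X2 *m (Y1 *m Z3)
  + X2 *m (Y3 *m Z1) + X3 *m (Y1 *m Z2) + X3 *m (Y2 *m Z1).
Proof.
rewrite !(mulmxDl, mulmxDr).
(* With the 27 products made opaque the identity is linear and can be checked entry by entry. *)
do 27!match goal with |- context [?a *m (?b *m ?c)] =>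
  generalize (a *m (b *m c)); intro end.
by apply/matrixP => i j; rewrite !mxE; ring.
Qed.

(** * The ideal in terms of coefficient functions *)

(** On coefficient functions, equalities in the free algebra become pointwise identities in [F],
    within reach of [ring]. *)
Definition inT (h : seq var -> F) : Prop := exists2 p, in_TI (@calI F) p & coef p =1 h.

Lemma inT_ext h h' : h =1 h' -> inT h -> inT h'.
Proof. by move=> hh' [p pI ph]; exists p => // w; rewrite ph. Qed.

Lemma inT0 : inT (fun=> 0).
Proof. by exists (Cst 0) => [|w]; [apply: TI_zero | rewrite /= mul0rn]. Qed.

Lemma inTD h h' : inT h -> inT h' -> inT (fun w => h w + h' w).
Proof.
by move=> [p pI ph] [q qI qh]; exists (Add p q) => [|w]; [apply: TI_add | rewrite /= ph qh].
Qed.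

Lemma coef_scale (c : F) p w : coef (Mul (Cst c) p) w = c * coef p w.
Proof.
rewrite /= big_ord_recl take0 drop0 eqxx big1 ?addr0 // => i _.
by rewrite -size_eq0 size_take; case: ltnP => [|/eqP]; case: w i => [[]//|a w] i;
  rewrite ?mul0r.
Qed.

Lemma inTZ (c : F) h : inT h -> inT (fun w => c * h w).
Proof.
move=> [p pI ph]; exists (Mul (Cst c) p); first exact: TI_mull.
by move=> w; rewrite coef_scale ph.
Qed.

Lemma inT_sum (I : Type) (r : seq I) (h : I -> seq var -> F) :
  (forall i, inT (h i)) -> inT (fun w => \sum_(i <- r) h i w).
Proof.
move=> hI; elim: r => [|i r IHr].
  by apply: inT_ext inT0 => w; rewrite big_nil.
by apply: inT_ext (inTD (hI i) IHr) => w; rewrite big_cons.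
Qed.

(** * Symmetric and skew elements and their substitution *)

(** The condition that [admissible] puts on the image of one variable. *)
Definition of_ttype (ty : bool * bool) (t : term F) : Prop :=
  (forall w, coef t w != 0 -> odd (nodd w) = ty.1) /\
  (forall w, starc (coef t) w = (if ty.2 then -1 else 1) * coef t w).

Lemma var_ttype x : of_ttype x.1 (Var F x).
Proof.
split=> w /=.
  have [-> _|_] := eqVneq w [:: x]; last by rewrite eqxx.
  by rewrite /nodd /= addn0 oddb.
rewrite /starc /koszul /epsw /= (inv_eq revK).
case: eqP => [->|_]; last by rewrite !mulr0.
rewrite /nodd /= !addn0 /var_skew !mulr1 bin_small; last by case: var_odd.
by rewrite expr0 mul1r; case: x.1.2.
Qed.

(** Allows 1 to be substituted for a missing variable in degree below 3. *)
Lemma one_ttype : of_ttype (false, false) (Cst (1 : F)).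
Proof.
split=> w /=; first by case: w => [|a w]; rewrite /= ?eqxx.
rewrite /starc /= (inv_eq revK); case: eqP => [->|_]; last by rewrite !mulr0.
by rewrite /koszul /epsw /nodd /= bin_small // expr0 !mul1r.
Qed.

Definition sgn (b : bool) : F := (-1) ^+ b.

(* [(x y)^* = sgn (swap_sgn x y) (y x)] *)
Definition swap_sgn x y : bool := (x.1.1 && y.1.1) (+) x.1.2 (+) y.1.2.

(** The sign makes the element symmetric for [b = false] and skew for [b = true]. *)
Definition jordan (b : bool) x y : term F :=
  Add (Mul (Var F x) (Var F y)) (Mul (Cst (sgn (b (+) swap_sgn x y))) (Mul (Var F y) (Var F x))).

Lemma coef_jordan b x y w :
  coef (jordan b x y) w = mon [:: x; y] w + sgn (b (+) swap_sgn x y) * mon [:: y; x] w.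
Proof. by rewrite coef_flat /= !big_cons big_nil /=; ring. Qed.

Lemma jordan_ttype b x y : of_ttype (x.1.1 (+) y.1.1, b) (jordan b x y).
Proof.
split=> w; rewrite ?/starc !coef_jordan /mon.
  have [->|_] := eqVneq w [:: x; y]; first by move=> _; rewrite /nodd /= addn0 oddD !oddb.
  have [->|_] := eqVneq w [:: y; x]; first by move=> _; rewrite /nodd /= addn0 oddD !oddb addbC.
  by rewrite mulr0 addr0 eqxx.
have rev2 x' y' : (rev w == [:: x'; y']) = (w == [:: y'; x']) by exact: (inv_eq revK).
rewrite !rev2.
have bin2 (c d : bool) : 'C(c + (d + 0), 2) = c && d by case: c; case: d.
have sgn2 x' y' : koszul F [:: x'; y'] * epsw F [:: x'; y'] = sgn (swap_sgn x' y').
  rewrite /koszul /epsw /nodd /= bin2 /sgn /swap_sgn addn0 exprD !signr_addb.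
  by rewrite mulrA.
have [->|nxy] := eqVneq w [:: x; y].
  (* The words xy and yx coincide if x = y, hence the split on their equality. *)
  by rewrite sgn2; case: (_ == _); case: b; case: swap_sgn; rewrite /sgn /=; ring.
have [->|nyx] := eqVneq w [:: y; x].
  have -> : swap_sgn x y = swap_sgn y x by rewrite /swap_sgn andbC addbAC.
  by rewrite sgn2; case: b; case: swap_sgn; rewrite /sgn /=; ring.
by rewrite !(mulr0, addr0).
Qed.

Definition assign3 x1 t1 x2 t2 x3 t3 : var -> term F :=
  fun x => if x == x1 then t1 else if x == x2 then t2 else if x == x3 then t3 else Var F x.

Lemma assign3_admissible x1 x2 x3 t1 t2 t3 :
  of_ttype x1.1 t1 -> of_ttype x2.1 t2 -> of_ttype x3.1 t3 ->
  admissible (assign3 x1 t1 x2 t2 x3 t3).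
Proof.
move=> h1 h2 h3 x; rewrite /assign3.
do 3!case: eqP => [-> //|_].
exact: var_ttype.
Qed.

Lemma in_TI_assign3 g x1 t1 x2 t2 x3 t3 : in_TI (@calI F) g ->
  of_ttype x1.1 t1 -> of_ttype x2.1 t2 -> of_ttype x3.1 t3 ->
  in_TI (@calI F) (subst (assign3 x1 t1 x2 t2 x3 t3) g).
Proof. by move=> gI h1 h2 h3; apply: TI_subst => //; apply: assign3_admissible. Qed.

Lemma in_TI_nth k : (k < 11)%N -> in_TI (@calI F) (nth (Cst 0) (gens F) k).
Proof.
move=> k11; apply: TI_gen; rewrite /calI.
by do 11!(case: k k11 => [_|k k11] /=; [tauto|]).
Qed.

(** * Consequences of the generators *)

Lemma comm_in_TI s a b :
  of_ttype (false, false) a -> of_ttype (false, s) b -> in_TI (@calI F) (comm a b).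
Proof.
move=> ha hb; case: s hb => hb.
  (* These generators have two variables; the third assignment repeats the first. *)
  exact: (in_TI_assign3 (x1 := (false, false, 1)) (x2 := (false, true, 1))
    (x3 := (false, false, 1)) (in_TI_nth (isT : 1 < 11)%N) ha hb ha).
exact: (in_TI_assign3 (x1 := (false, false, 1)) (x2 := (false, false, 2))
  (x3 := (false, false, 1)) (in_TI_nth (isT : 0 < 11)%N) ha hb ha).
Qed.

Lemma coef_in_TI p h : in_TI (@calI F) p -> coef p =1 h -> inT h.
Proof. by exists p. Qed.

Lemma comm_mull s x y z : x.1 = (false, false) -> y.1 = (false, s) ->
  inT (fun w => mon [:: x; y; z] w - mon [:: y; x; z] w).
Proof.
move=> hx hy; have hX := var_ttype x; have hY := var_ttype y.
rewrite hx in hX; rewrite hy in hY.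
apply: (coef_in_TI (TI_mulr (Var F z) (comm_in_TI hX hY))) => w.
by rewrite coef_flat /= !big_cons big_nil /=; ring.
Qed.

Lemma comm_mulr s x y z : y.1 = (false, false) -> z.1 = (false, s) ->
  inT (fun w => mon [:: x; y; z] w - mon [:: x; z; y] w).
Proof.
move=> hy hz; have hY := var_ttype y; have hZ := var_ttype z.
rewrite hy in hY; rewrite hz in hZ.
apply: (coef_in_TI (TI_mull (Var F x) (comm_in_TI hY hZ))) => w.
by rewrite coef_flat /= !big_cons big_nil /=; ring.
Qed.

(** This is the commutator of y with xz ± zx. The latter is even because x and z have equal parity,
    and the condition on [b] makes one of the two entries symmetric. *)
Lemma comm_jordan b x y z : y.1.1 = false -> x.1.1 = z.1.1 -> y.1.2 && b = false ->
  inT (fun w => mon [:: y; x; z] w - mon [:: x; z; y] w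
    + sgn (b (+) swap_sgn x z) * (mon [:: y; z; x] w - mon [:: z; x; y] w)).
Proof.
move=> y0 xz yb; have hY := var_ttype y; have hJ := jordan_ttype b x z.
move: hY hJ; rewrite (surjective_pairing y.1) y0 xz addbb => hY hJ.
have [pI|pI] : in_TI (@calI F) (comm (Var F y) (jordan b x z)) \/
               in_TI (@calI F) (comm (jordan b x z) (Var F y)).
- case: y.1.2 yb hY => [/= b0|_] hY; last by left; apply: comm_in_TI hY hJ.
  by right; apply: comm_in_TI _ hY; rewrite -[X in (false, X)]b0.
- apply: (coef_in_TI pI) => w; rewrite coef_flat /= !big_cons big_nil /=; ring.
(* The generator has its symmetric entry first, so for skew y the commutator appears reversed and
   changes sign. *)
have mI : in_TI (@calI F) (Mul (Cst (-1)) (comm (jordan b x z) (Var F y))) by apply: TI_mull.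
apply: (coef_in_TI mI) => w; rewrite coef_flat /= !big_cons big_nil /=; ring.
Qed.

(* [2 x z] is the sum of its symmetric and skew parts, and [y] commutes with both. *)
Lemma comm_pair y x z : y.1 = (false, false) -> x.1.1 = z.1.1 ->
  inT (fun w => mon [:: y; x; z] w - mon [:: x; z; y] w).
Proof.
move=> hy xz; have y0 : y.1.1 = false by rewrite hy.
have yb b : y.1.2 && b = false by rewrite hy.
have n2 : 2 != 0 :> F := natr_neq0 1.
have I0 := comm_jordan y0 xz (yb false); have I1 := comm_jordan y0 xz (yb true).
apply: inT_ext (inTZ 2^-1 (inTD I0 I1)) => w.
have -> : sgn (true (+) swap_sgn x z) = - sgn (false (+) swap_sgn x z).
  by case: swap_sgn; rewrite /sgn /= ?opprK.
by field.
Qed.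

(** [k] is the position of the generator in [gens], counted from 0, and [i1], [i2], [i3] are the
    indices of its variables there. *)
Lemma gen3_in_TI k x y z (h : seq var -> F) i1 i2 i3 : (k < 11)%N ->
  (forall w, coef (subst (assign3 (x.1, i1) (Var F x) (y.1, i2) (Var F y)
    (z.1, i3) (Var F z)) (nth (Cst 0) (gens F) k)) w = h w) -> inT h.
Proof.
move=> k11; apply: coef_in_TI.
apply: in_TI_assign3; first exact: in_TI_nth.
- exact: (var_ttype x).
- exact: (var_ttype y).
- exact: (var_ttype z).
Qed.

Ltac gen3 k x y z i1 i2 i3 :=
  apply: (@gen3_in_TI k x y z _ i1 i2 i3) => // w;
  rewrite coef_flat /= !big_cons big_nil /=; ring.

Lemma even_odd_even s x y z :
  x.1 = (false, true) -> y.1 = (true, s) -> z.1 = (false, true) -> inT (mon [:: x; y; z]).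
Proof.
case: x y z => [_ i] [_ j] [_ k] /= -> -> ->; case: s.
  gen3 3%N (false, true, i) (true, true, j) (false, true, k) 1%N 1%N 2%N.
gen3 2%N (false, true, i) (true, false, j) (false, true, k) 1%N 1%N 2%N.
Qed.

Lemma odd_cyclic s x y z : x.1 = (true, s) -> y.1 = (true, s) -> z.1 = (true, s) ->
  inT (fun w => mon [:: x; y; z] w + mon [:: y; z; x] w + mon [:: z; x; y] w).
Proof.
case: x y z => [_ i] [_ j] [_ k] /= -> -> ->; case: s.
  gen3 5%N (true, true, i) (true, true, j) (true, true, k) 1%N 2%N 3%N.
gen3 4%N (true, false, i) (true, false, j) (true, false, k) 1%N 2%N 3%N.
Qed.

Lemma odd_mixed s x y z : x.1 = (true, s) -> y.1 = (true, s) -> z.1 = (true, ~~ s) ->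
  inT (fun w => mon [:: x; y; z] w - mon [:: y; z; x] w + mon [:: z; x; y] w).
Proof.
case: x y z => [_ i] [_ j] [_ k] /= -> -> ->; case: s.
  gen3 9%N (true, true, i) (true, true, j) (true, false, k) 1%N 2%N 1%N.
gen3 8%N (true, false, i) (true, false, j) (true, true, k) 1%N 2%N 1%N.
Qed.

Lemma odd_even_odd s s' x y z :
  x.1 = (true, s) -> y.1 = (false, true) -> z.1 = (true, s') ->
  inT (fun w => mon [:: x; y; z] w - sgn (s (+) s') * mon [:: z; y; x] w).
Proof.
case: x y z => [_ i] [_ j] [_ k] /= -> -> ->; case: s; case: s'; rewrite /sgn /=.
- gen3 7%N (true, true, i) (false, true, j) (true, true, k) 1%N 1%N 2%N.
(* The first word of the last generator begins with the symmetric variable, which is z here. *)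
- gen3 10%N (true, false, k) (false, true, j) (true, true, i) 1%N 1%N 1%N.
- gen3 10%N (true, false, i) (false, true, j) (true, true, k) 1%N 1%N 1%N.
gen3 6%N (true, false, i) (false, true, j) (true, false, k) 1%N 1%N 2%N.
Qed.

(** * Coordinates on the four homogeneous parts *)

Definition mx3 (a b c d e f g h i : F) : 'M[F]_3 :=
  \matrix_(r < 3, s < 3)
    nth 0 (nth [::] [:: [:: a; b; c]; [:: d; e; f]; [:: g; h; i]] r) s.

Lemma mx3_mul a b c d e f g h i a' b' c' d' e' f' g' h' i' :
  mx3 a b c d e f g h i *m mx3 a' b' c' d' e' f' g' h' i' =
  mx3 (a * a' + b * d' + c * g') (a * b' + b * e' + c * h') (a * c' + b * f' + c * i')
      (d * a' + e * d' + f * g') (d * b' + e * e' + f * h') (d * c' + e * f' + f * i')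
      (g * a' + h * d' + i * g') (g * b' + h * e' + i * h') (g * c' + h * f' + i * i').
Proof.
apply/matrixP=> -[[|[|[|//]]] ?] [[|[|[|//]]] ?];
  by rewrite !mxE !big_ord_recl big_ord0 /= !mxE /= addr0 addrA.
Qed.

(** General elements of the parts: the span of e11 and e22 + e33, a copy of sl_2 in the lower right
    block, and two planes of odd matrices that differ in the sign of the first column. *)
Definition even_sym (a b : F) := mx3 a 0 0 0 b 0 0 0 b.
Definition even_skew (p q r : F) := mx3 0 0 0 0 p q 0 r (- p).
Definition odd_mx s b c := mx3 0 b c (sgn s * c) 0 0 (- sgn s * b) 0 0.

Lemma even_sym_type a b : of_type (false, false) (even_sym a b).
Proof.
by split=> [|]; [|apply/matrixP]; move=> [[|[|[|//]]] ?] [[|[|[|//]]] ?];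
  rewrite !mxE //= ?mxE //= oppr0.
Qed.

Lemma even_skew_type (p q r : F) : of_type (false, true) (even_skew p q r).
Proof.
by split=> [|]; [|apply/matrixP]; move=> [[|[|[|//]]] ?] [[|[|[|//]]] ?];
  rewrite !mxE //= ?mxE //= ?oppr0 ?opprK.
Qed.

Lemma odd_mx_type s b c : of_type (true, s) (odd_mx s b c).
Proof.
by split=> [|]; [|apply/matrixP]; move=> [[|[|[|//]]] ?] [[|[|[|//]]] ?];
  rewrite /odd_mx /sgn; case: s; rewrite !mxE //= ?mxE //=; ring.
Qed.

(** * Multilinear elements, one triple of types at a time *)

Definition vanishing c1 c2 c3 c4 c5 c6 t1 t2 t3 : Prop :=
  forall A B C : 'M[F]_3, of_type t1 A -> of_type t2 B -> of_type t3 C ->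
  comb6 c1 c2 c3 c4 c5 c6 A B C = 0.

Definition word6 c1 c2 c3 c4 c5 c6 x y z w : F :=
  c1 * mon [:: x; y; z] w + c2 * mon [:: x; z; y] w + c3 * mon [:: y; x; z] w
  + c4 * mon [:: y; z; x] w + c5 * mon [:: z; x; y] w + c6 * mon [:: z; y; x] w.

(** The variables may coincide; [vanishing] still substitutes independent matrices. *)
Definition solved x y z : Prop := forall c1 c2 c3 c4 c5 c6,
  vanishing c1 c2 c3 c4 c5 c6 x.1 y.1 z.1 -> inT (word6 c1 c2 c3 c4 c5 c6 x y z).

(** Solves a vanishing entry [e] for the coefficient [c]; the factor [k] undoes the sign with which
    [c] occurs in it. *)
Lemma solve (c d k e : F) : e = 0 -> c - d = k * e -> c = d.
Proof. by move=> ->; rewrite mulr0 => /eqP; rewrite subr_eq0 => /eqP. Qed.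

Lemma entry c1 c2 c3 c4 c5 c6 t1 t2 t3 A B C (i j : 'I_3) :
  vanishing c1 c2 c3 c4 c5 c6 t1 t2 t3 -> of_type t1 A -> of_type t2 B -> of_type t3 C ->
  comb6 c1 c2 c3 c4 c5 c6 A B C i j = 0.
Proof. by move=> V hA hB hC; rewrite V // mxE. Qed.

Lemma sgnK s : sgn s * sgn s = 1.
Proof. by case: s; rewrite /sgn /= ?expr1 ?expr0; ring. Qed.

Lemma sgnD s s' : sgn (s (+) s') = sgn s * sgn s'.
Proof. exact: signr_addb. Qed.

Lemma sgnN s : sgn (~~ s) = - sgn s.
Proof. by case: s; rewrite /sgn /= ?opprK. Qed.

Definition unit_simpl := (mul0r, mulr0, addr0, add0r, mul1r, mulr1, oppr0).

Ltac entry_as E V i j hA hB hC :=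
  have E := entry i j V hA hB hC;
  rewrite /comb6 /even_sym /even_skew /odd_mx !mx3_mul !mxE /= !unit_simpl in E.

(** Putting e11 and e22 + e33 on the two sides of z isolates xzy and yzx; what remains is spanned by
    [x,y]z and z[x,y]. *)
Lemma solved_sym_sym_odd s x y z :
  x.1 = (false, false) -> y.1 = (false, false) -> z.1 = (true, s) -> solved x y z.
Proof.
move=> hx hy hz c1 c2 c3 c4 c5 c6; rewrite hx hy hz => V.
have Y := even_sym_type; have Z := odd_mx_type s 1 1.
entry_as E1 V (0 : 'I_3) (1 : 'I_3) (Y 1 0) (Y 1 0) Z.
entry_as E2 V (1 : 'I_3) (0 : 'I_3) (Y 1 0) (Y 1 0) Z.
entry_as E3 V (0 : 'I_3) (1 : 'I_3) (Y 1 0) (Y 0 1) Z.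
entry_as E4 V (1 : 'I_3) (0 : 'I_3) (Y 1 0) (Y 0 1) Z.
have c3E : c3 = - c1 by apply: (solve (k := 1) E1); ring.
have c6E : c6 = - c5 by apply: (solve (k := sgn s) E2); ring: (sgnK s).
have c4E : c4 = 0 by apply: (solve (k := sgn s) E4); ring: (sgnK s).
apply: inT_ext (inTD (inTZ c1 (comm_mull z hx hy)) (inTZ c5 (comm_mulr z hx hy))) => w.
by rewrite /word6 c3E c6E E3 c4E; ring.
Qed.

(** As e11 annihilates y, x = e11 isolates xzy and yzx; x = e22 + e33 then leaves [x,y]z and
    z[x,y]. *)
Lemma solved_sym_skew_odd s x y z :
  x.1 = (false, false) -> y.1 = (false, true) -> z.1 = (true, s) -> solved x y z.
Proof.
move=> hx hy hz c1 c2 c3 c4 c5 c6; rewrite hx hy hz => V.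
have Y := even_sym_type; have S := even_skew_type 1 0 0; have Z := odd_mx_type s 1 1.
entry_as E1 V (1 : 'I_3) (0 : 'I_3) (Y 1 0) S Z.
entry_as E2 V (0 : 'I_3) (1 : 'I_3) (Y 1 0) S Z.
entry_as E3 V (1 : 'I_3) (0 : 'I_3) (Y 0 1) S Z.
entry_as E4 V (0 : 'I_3) (1 : 'I_3) (Y 0 1) S Z.
have c4E : c4 = 0 by apply: (solve (k := sgn s) E1); ring: (sgnK s).
have c3E : c3 = - c1 by apply: (solve (k := sgn s) E3); ring: (sgnK s).
have c6E : c6 = - c5 by apply: (solve (k := 1) E4); ring.
apply: inT_ext (inTD (inTZ c1 (comm_mull z hx hy)) (inTZ c5 (comm_mulr z hx hy))) => w.
by rewrite /word6 c3E c6E E2 c4E; ring.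
Qed.

(** Even skew matrices live in the lower right block, where odd ones are zero, so xzy and yzx are
    unconstrained. The products e23 e32 = e22 and e32 e23 = e33 isolate the other four words. *)
Lemma solved_skew_skew_odd s x y z :
  x.1 = (false, true) -> y.1 = (false, true) -> z.1 = (true, s) -> solved x y z.
Proof.
move=> hx hy hz c1 c2 c3 c4 c5 c6; rewrite hx hy hz => V.
have Z := odd_mx_type s 1 1.
have S := even_skew_type 0 1 0; have T := even_skew_type 0 0 1.
entry_as E1 V (0 : 'I_3) (1 : 'I_3) S T Z.
entry_as E2 V (0 : 'I_3) (2 : 'I_3) S T Z.
entry_as E3 V (1 : 'I_3) (0 : 'I_3) S T Z.
entry_as E4 V (2 : 'I_3) (0 : 'I_3) S T Z.
have c1E : c1 = 0 by apply: (solve (k := sgn s) E3); ring: (sgnK s).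
have c3E : c3 = 0 by apply: (solve (k := - sgn s) E4); ring: (sgnK s).
apply: inT_ext (inTD (inTZ c2 (even_odd_even hx hz hy)) (inTZ c4 (even_odd_even hy hz hx))).
by move=> w; rewrite /word6 c1E c3E E1 E2; ring.
Qed.

(** The chosen y and z have diagonal products. Then x = e22 + e33 pairs xyz with yzx and xzy with
    zyx, and x = e11 isolates yxz and zxy; [x,yz] and [x,zy] remain. *)
Lemma solved_sym_odd_odd s s' x y z :
  x.1 = (false, false) -> y.1 = (true, s) -> z.1 = (true, s') -> solved x y z.
Proof.
move=> hx hy hz c1 c2 c3 c4 c5 c6; rewrite hx hy hz => V.
have Y := even_sym_type; have Z := odd_mx_type s 1 0; have Z' := odd_mx_type s' 0 1.
entry_as E1 V (2 : 'I_3) (2 : 'I_3) (Y 0 1) Z Z'.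
entry_as E2 V (1 : 'I_3) (1 : 'I_3) (Y 0 1) Z Z'.
entry_as E3 V (2 : 'I_3) (2 : 'I_3) (Y 1 0) Z Z'.
entry_as E4 V (1 : 'I_3) (1 : 'I_3) (Y 1 0) Z Z'.
have c4E : c4 = - c1 by apply: (solve (k := - sgn s) E1); ring: (sgnK s).
have c6E : c6 = - c2 by apply: (solve (k := sgn s') E2); ring: (sgnK s').
have c3E : c3 = 0 by apply: (solve (k := - sgn s) E3); ring: (sgnK s).
have c5E : c5 = 0 by apply: (solve (k := sgn s') E4); ring: (sgnK s').
have yz : y.1.1 = z.1.1 by rewrite hy hz.
apply: inT_ext
  (inTD (inTZ c1 (comm_pair hx yz)) (inTZ c2 (comm_pair hx (esym yz)))) => w.
by rewrite /word6 c3E c4E c5E c6E; ring.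
Qed.

(** With e the sign [sgn s * sgn s'], the solutions are spanned by [x, yz - e zy], whose second
    entry is symmetric, and yxz - e zxy. *)
Lemma solved_skew_odd_odd s s' x y z :
  x.1 = (false, true) -> y.1 = (true, s) -> z.1 = (true, s') -> solved x y z.
Proof.
move=> hx hy hz c1 c2 c3 c4 c5 c6; rewrite hx hy hz => V.
have S := even_skew_type 1 0 0; have T := even_skew_type 0 1 0.
have Z := odd_mx_type s 1 0; have Z' := odd_mx_type s' 0 1.
entry_as E1 V (0 : 'I_3) (0 : 'I_3) S Z Z'.
entry_as E2 V (2 : 'I_3) (2 : 'I_3) S Z Z'.
entry_as E3 V (1 : 'I_3) (1 : 'I_3) S Z Z'.
entry_as E4 V (1 : 'I_3) (2 : 'I_3) T Z Z'.
have c5E : c5 = - (sgn s * sgn s') * c3.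
  by apply: (solve (k := sgn s) E1); ring: (sgnK s).
have c4E : c4 = - c1 by apply: (solve (k := sgn s) E2); ring: (sgnK s).
have c6E : c6 = sgn s * sgn s' * c1.
  by apply: (solve (k := sgn s') E4); ring: (sgnK s').
have c2E : c2 = - (sgn s * sgn s') * c1.
  by rewrite c6E in E3; apply: (solve (k := sgn s') E3); ring: (sgnK s').
have J : inT (fun w => mon [:: x; y; z] w - mon [:: y; z; x] w
    - sgn s * sgn s' * (mon [:: x; z; y] w - mon [:: z; y; x] w)).
  have := @comm_jordan false y x z; rewrite /swap_sgn hx hy hz /= sgnD sgnN.
  by move=> /(_ erefl erefl erefl); apply: inT_ext => w; ring.
apply: inT_ext (inTD (inTZ c1 J) (inTZ c3 (odd_even_odd hy hx hz))) => w.
by rewrite /word6 c2E c4E c5E c6E sgnD; ring.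
Qed.

Lemma solved_sym_sym_even s x y z :
  x.1 = (false, false) -> y.1 = (false, false) -> z.1 = (false, s) -> solved x y z.
Proof.
move=> hx hy hz c1 c2 c3 c4 c5 c6; rewrite hx hy hz => V.
have c6E : c6 = - (c1 + c2 + c3 + c4 + c5).
  have Y := even_sym_type 1 1; case: s V {hz} => V.
    entry_as E V (1 : 'I_3) (1 : 'I_3) Y Y (even_skew_type 1 0 0).
    by apply: (solve (k := 1) E); ring.
  entry_as E V (1 : 'I_3) (1 : 'I_3) Y Y Y.
  by apply: (solve (k := 1) E); ring.
(* Summation by parts along zxy, xzy, xyz, yxz, yzx, zyx: neighbours differ by a commutator, and the
   weights are partial sums of the coefficients, up to sign. *)
apply: inT_ext (inTD (inTD (inTD (inTD
  (inTZ (c1 + c2 + c5) (comm_mull z hx hy)) (inTZ (- c2 - c5) (comm_mulr x hy hz)))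
  (inTZ (c1 + c2 + c3 + c5) (comm_mulr y hx hz))) (inTZ (- c5) (comm_mull y hx hz)))
  (inTZ (c1 + c2 + c3 + c4 + c5) (comm_mull x hy hz))) => w.
by rewrite /word6 c6E; ring.
Qed.

(** Since x commutes with y and z, only the order of y and z matters; e23 and e32 separate the two
    orders. *)
Lemma solved_sym_skew_skew x y z :
  x.1 = (false, false) -> y.1 = (false, true) -> z.1 = (false, true) -> solved x y z.
Proof.
move=> hx hy hz c1 c2 c3 c4 c5 c6; rewrite hx hy hz => V.
have Y := even_sym_type 0 1.
have S := even_skew_type 0 1 0; have T := even_skew_type 0 0 1.
entry_as E1 V (1 : 'I_3) (1 : 'I_3) Y S T.
entry_as E2 V (2 : 'I_3) (2 : 'I_3) Y S T.
have c4E : c4 = - c1 - c3 by apply: (solve (k := 1) E1); ring.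
have c6E : c6 = - c2 - c5 by apply: (solve (k := 1) E2); ring.
apply: inT_ext (inTD
  (inTD (inTZ c1 (comm_mull z hx hy)) (inTZ (c1 + c3) (comm_mulr y hx hz)))
  (inTD (inTZ c2 (comm_mull y hx hz)) (inTZ (c2 + c5) (comm_mulr z hx hy)))) => w.
by rewrite /word6 c4E c6E; ring.
Qed.

(** In sl_2 the element yz + zy is scalar. The equations leave exactly the span of [x, yz + zy] and
    [y, xz + zx]. *)
Lemma solved_skew_skew_skew x y z :
  x.1 = (false, true) -> y.1 = (false, true) -> z.1 = (false, true) -> solved x y z.
Proof.
move=> hx hy hz c1 c2 c3 c4 c5 c6; rewrite hx hy hz => V.
have H := even_skew_type 1 0 0.
have S := even_skew_type 0 1 0; have T := even_skew_type 0 0 1.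
entry_as E1 V (1 : 'I_3) (1 : 'I_3) H S T.
entry_as E2 V (1 : 'I_3) (1 : 'I_3) S H T.
entry_as E3 V (1 : 'I_3) (1 : 'I_3) S T H.
entry_as E4 V (2 : 'I_3) (2 : 'I_3) S T H.
have c4E : c4 = c3 - c1 by apply: (solve (k := 1) E1); ring.
have c2E : c2 = c1 - c3 by apply: (solve (k := 1) E2); ring.
have c5E : c5 = - c3 by rewrite c2E in E3; apply: (solve (k := 1) E3); ring.
have c6E : c6 = - c1 by rewrite c4E in E4; apply: (solve (k := - 1) E4); ring.
have J (u v t : var) : u.1 = (false, true) -> v.1 = (false, true) -> t.1 = (false, true) ->
    inT (fun w => mon [:: u; v; t] w - mon [:: v; t; u] w
      + (mon [:: u; t; v] w - mon [:: t; v; u] w)).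
  move=> hu hv ht; have := @comm_jordan false v u t; rewrite /swap_sgn hu hv ht /sgn expr0.
  by move=> /(_ erefl erefl erefl); apply: inT_ext => w; ring.
apply: inT_ext (inTD (inTZ c1 (J x y z hx hy hz)) (inTZ c3 (J y x z hy hx hz))) => w.
by rewrite /word6 c2E c4E c5E c6E; ring.
Qed.

(** R and T span the odd part of this type. The equations force equal coefficients along each of the
    two cyclic classes of words. *)
Lemma solved_odd s x y z :
  x.1 = (true, s) -> y.1 = (true, s) -> z.1 = (true, s) -> solved x y z.
Proof.
move=> hx hy hz c1 c2 c3 c4 c5 c6; rewrite hx hy hz => V.
have n3 : 3 != 0 :> F := natr_neq0 2.
have R := odd_mx_type s 1 0; have T := odd_mx_type s 0 1.
entry_as E1 V (0 : 'I_3) (1 : 'I_3) R T R.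
entry_as E2 V (0 : 'I_3) (2 : 'I_3) R T T.
entry_as E3 V (1 : 'I_3) (0 : 'I_3) R T T.
entry_as E4 V (2 : 'I_3) (0 : 'I_3) R T R.
have e1 : c1 - c3 - c4 + c6 = 0 by apply: (solve (k := sgn s) E1); ring: (sgnK s).
have e2 : c1 + c2 - c3 - c5 = 0 by apply: (solve (k := sgn s) E2); ring: (sgnK s).
have e3 : c3 - c4 + c5 - c6 = 0 by apply: (solve (k := 1) E3); ring: (sgnK s).
have e4 : c1 - c2 - c5 + c6 = 0 by apply: (solve (k := 1) E4); ring: (sgnK s).
have c4E : c4 = c1.
  (* [3 (c4 - c1) = - (e1 + e2 + 2 e3 + e4)] *)
  apply: (mulfI n3); apply: (solve (k := - 1) (e := 0 + 0 + 2 * 0 + 0)); first by ring.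
  by rewrite -{1}e1 -{1}e2 -{1}e3 -e4; ring.
rewrite {}c4E in e1 e3 *.
have c6E : c6 = c3 by apply: (solve (k := 1) e1); ring.
rewrite {}c6E in e3 *.
have c5E : c5 = c1 by apply: (solve (k := 1) e3); ring.
rewrite {}c5E in e2 *.
have -> : c2 = c3 by apply: (solve (k := 1) e2); ring.
apply: inT_ext (inTD (inTZ c1 (odd_cyclic hx hy hz)) (inTZ c3 (odd_cyclic hy hx hz))) => w.
by rewrite /word6; ring.
Qed.

(** As for equal types, [c1] and [c3] determine the rest, now with the signs of the mixed
    generators. *)
Lemma solved_odd_mixed s x y z :
  x.1 = (true, s) -> y.1 = (true, s) -> z.1 = (true, ~~ s) -> solved x y z.
Proof.
move=> hx hy hz c1 c2 c3 c4 c5 c6; rewrite hx hy hz => V.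
have n3 : 3 != 0 :> F := natr_neq0 2.
have R := odd_mx_type s 1 0; have T := odd_mx_type s 0 1.
have R' := odd_mx_type (~~ s) 1 0; have T' := odd_mx_type (~~ s) 0 1.
entry_as E1 V (0 : 'I_3) (1 : 'I_3) R T R'.
entry_as E2 V (0 : 'I_3) (2 : 'I_3) R T T'.
entry_as E3 V (1 : 'I_3) (0 : 'I_3) R T T'.
entry_as E4 V (2 : 'I_3) (0 : 'I_3) R T R'.
rewrite !sgnN in E1 E2 E3 E4.
have e1 : c1 - c3 + c4 + c6 = 0 by apply: (solve (k := sgn s) E1); ring: (sgnK s).
have e2 : c1 - c2 - c3 - c5 = 0 by apply: (solve (k := sgn s) E2); ring: (sgnK s).
have e3 : - c3 - c4 - c5 + c6 = 0 by apply: (solve (k := 1) E3); ring: (sgnK s).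
have e4 : - c1 - c2 + c5 - c6 = 0 by apply: (solve (k := 1) E4); ring: (sgnK s).
have c4E : c4 = - c1.
  (* [3 (c4 + c1) = e1 + e2 - 2 e3 - e4] *)
  apply: (mulfI n3); apply: (solve (k := 1) (e := 0 + 0 - 2 * 0 - 0)); first by ring.
  by rewrite -{1}e1 -{1}e2 -{1}e3 -e4; ring.
rewrite {}c4E in e1 e3 *.
have c6E : c6 = c3 by apply: (solve (k := 1) e1); ring.
rewrite {}c6E in e3 *.
have c5E : c5 = c1 by apply: (solve (k := - 1) e3); ring.
rewrite {}c5E in e2 *.
have -> : c2 = - c3 by apply: (solve (k := - 1) e2); ring.
apply: inT_ext (inTD (inTZ c1 (odd_mixed hx hy hz)) (inTZ c3 (odd_mixed hy hx hz))) => w.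
by rewrite /word6; ring.
Qed.

(** * Arbitrary triples of types *)

Definition comb_term (c1 c2 c3 c4 c5 c6 : F) (a b c : term F) : term F :=
  Add (Add (Add (Add (Add (Mul (Cst c1) (M3 a b c)) (Mul (Cst c2) (M3 a c b)))
    (Mul (Cst c3) (M3 b a c))) (Mul (Cst c4) (M3 b c a))) (Mul (Cst c5) (M3 c a b)))
    (Mul (Cst c6) (M3 c b a)).

Lemma comb6_swap12 c1 c2 c3 c4 c5 c6 A B C :
  comb6 c1 c2 c3 c4 c5 c6 A B C = comb6 c3 c4 c1 c2 c6 c5 B A C.
Proof.
rewrite /comb6; do 6!match goal with |- context [?a *m ?b *m ?c] =>
  generalize (a *m b *m c); intro end.
by apply/matrixP => i j; rewrite !mxE; ring.
Qed.

Lemma comb6_swap23 c1 c2 c3 c4 c5 c6 A B C :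
  comb6 c1 c2 c3 c4 c5 c6 A B C = comb6 c2 c1 c5 c6 c3 c4 A C B.
Proof.
rewrite /comb6; do 6!match goal with |- context [?a *m ?b *m ?c] =>
  generalize (a *m b *m c); intro end.
by apply/matrixP => i j; rewrite !mxE; ring.
Qed.

Lemma solved_swap12 x y z : solved x y z -> solved y x z.
Proof.
move=> S c1 c2 c3 c4 c5 c6 V; have := S c3 c4 c1 c2 c6 c5 _.
case=> [A B C hA hB hC|p pI pE]; first by rewrite comb6_swap12 V.
by exists p => // w; rewrite pE /word6; ring.
Qed.

Lemma solved_swap23 x y z : solved x y z -> solved x z y.
Proof.
move=> S c1 c2 c3 c4 c5 c6 V; have := S c2 c1 c5 c6 c3 c4 _.
case=> [A B C hA hB hC|p pI pE]; first by rewrite comb6_swap23 V.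
by exists p => // w; rewrite pE /word6; ring.
Qed.

Ltac sorted_case := first
  [ refine (solved_sym_sym_odd _ _ _); reflexivity
  | refine (solved_sym_skew_odd _ _ _); reflexivity
  | refine (solved_skew_skew_odd _ _ _); reflexivity
  | refine (solved_sym_odd_odd _ _ _); reflexivity
  | refine (solved_skew_odd_odd _ _ _); reflexivity
  | refine (solved_sym_sym_even _ _ _); reflexivity
  | refine (solved_sym_skew_skew _ _ _); reflexivity
  | refine (solved_skew_skew_skew _ _ _); reflexivity
  | refine (solved_odd _ _ _); reflexivity
  | refine (solved_odd_mixed (s := false) _ _ _); reflexivity
  | refine (solved_odd_mixed (s := true) _ _ _); reflexivity].

(** The ten sorted cases cover all 64 triples up to order; the alternatives run through the six
    permutations. *)
Lemma solved_all x y z : solved x y z.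
Proof.
case: x y z => [[[] []] i] [[[] []] j] [[[] []] k]; first
  [ sorted_case
  | apply: solved_swap12; sorted_case
  | apply: solved_swap23; sorted_case
  | apply: solved_swap12; apply: solved_swap23; sorted_case
  | apply: solved_swap23; apply: solved_swap12; sorted_case
  | apply: solved_swap12; apply: solved_swap23; apply: solved_swap12; sorted_case ].
Qed.

Lemma comb_term_in_TI c1 c2 c3 c4 c5 c6 t1 t2 t3 a b c :
  vanishing c1 c2 c3 c4 c5 c6 t1 t2 t3 ->
  of_ttype t1 a -> of_ttype t2 b -> of_ttype t3 c ->
  in_TI (@calI F) (comb_term c1 c2 c3 c4 c5 c6 a b c).
Proof.
(* The indices 1, 2, 3 keep the variables distinct even for equal types, so that a, b, c can be
   substituted independently. *)
move=> V ha hb hc; pose x : var := (t1, 1); pose y : var := (t2, 2); pose z : var := (t3, 3).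
have [p pI pE] := @solved_all x y z _ _ _ _ _ _ V.
have I : in_TI (@calI F) (comb_term c1 c2 c3 c4 c5 c6 (Var F x) (Var F y) (Var F z)).
  apply: TI_eq pI => w; rewrite pE [RHS]coef_flat /= !big_cons big_nil /word6 /=; ring.
have := in_TI_assign3 (x1 := x) (x2 := y) (x3 := z) I ha hb hc.
have yx : (y == x) = false by rewrite /y /x xpair_eqE andbF.
have zx : (z == x) = false by rewrite /z /x xpair_eqE andbF.
have zy : (z == y) = false by rewrite /z /y xpair_eqE andbF.
by rewrite /= /assign3 !eqxx yx zx zy.
Qed.

(** * Homogeneous components of an identity and their polarization *)

Section Identity.
Variable f : term F.
Hypothesis f_id : star_identity f.
Hypothesis f_deg : degree_le f 3.

(** The component of degree k with word w replaced by [g w]; a general [g] allows differences of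
    several evaluations. *)
Definition hsum k (g : seq var -> 'M[F]_3) : 'M[F]_3 :=
  \sum_(w <- words_of f | size w == k) coef f w *: g w.

Lemma hsumD k g h : hsum k (fun w => g w + h w) = hsum k g + hsum k h.
Proof. by rewrite /hsum; under eq_bigr do rewrite scalerDr; rewrite big_split. Qed.

Lemma hsumB k g h : hsum k (fun w => g w - h w) = hsum k g - hsum k h.
Proof. by rewrite /hsum; under eq_bigr do rewrite scalerBr; rewrite sumrB. Qed.

Lemma eq_hsum k g h : (forall w, size w = k -> g w = h w) -> hsum k g = hsum k h.
Proof. by move=> gh; apply: eq_bigr => w /eqP/gh ->. Qed.

Lemma hsum_mon u A : hsum (size u) (fun w => mon u w *: A) = coef f u *: A.
Proof. exact: (@sum_mon _ _ (fun w => size w == size u)). Qed.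

Definition hpart k e := hsum k (eprod e).

Lemma eprodZ (a : F) e w : eprod (fun x => a *: e x) w = a ^+ size w *: eprod e w.
Proof.
elim: w => [|x w /= ->]; first by rewrite scale1r.
by rewrite -scalemxAl -scalemxAr scalerA exprS.
Qed.

Lemma eval_scale (a : F) e :
  eval (fun x => a *: e x) f =
  hpart 0 e + a *: hpart 1 e + a ^+ 2 *: hpart 2 e + a ^+ 3 *: hpart 3 e.
Proof.
rewrite eval_words_of /hpart /hsum !scaler_sumr !(big_mkcond (fun w => size w == _)) /=.
rewrite -!big_split /=; apply: eq_bigr => w _; rewrite eprodZ.
have [->|cw] := eqVneq (coef f w) 0.
  by rewrite !(scale0r, scaler0, if_same, addr0).
have := f_deg cw; rewrite !scalerA.
case: (size w) => [|[|[|[|//]]]] _ /=; rewrite ?addr0 ?add0r ?mul1r ?mulr1 //.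
- by rewrite expr1 mulrC.
- by rewrite [in RHS]mulrC.
- by rewrite [in RHS]mulrC.
Qed.

(** Scaling [e] by a keeps it admissible, so every entry is a cubic in a that vanishes
    identically. *)
Lemma hpart_id k e : (k <= 3)%N -> admissible_eval e -> hpart k e = 0.
Proof.
move=> lek3 he; apply/matrixP => i j; rewrite [RHS]mxE.
have [|h0 h1 h2 h3] := @cubic_eq0 (hpart 0 e i j) (hpart 1 e i j) (hpart 2 e i j) (hpart 3 e i j).
  move=> a; have := congr1 (fun M : 'M_3 => M i j) (eval_scale a e).
  have ae : admissible_eval (fun x => a *: e x).
    by move=> x; apply: (of_typeZ (t := x.1)); apply: he.
  by rewrite (f_id ae) !mxE.
by case: k lek3 => [|[|[|[|//]]]] _.
Qed.

(** Zero away from x. For coinciding variables the values in a sum of such evaluations add up, so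
    polarization covers repeated letters. *)
Definition dirac x A : var -> 'M[F]_3 := fun y => (y == x)%:R *: A.

Lemma dirac_type x A y : of_type x.1 A -> of_type y.1 (dirac x A y).
Proof.
move=> hA; rewrite /dirac; have [->|_] := eqVneq y x; first exact: of_typeZ.
by rewrite scale0r; apply: of_type0.
Qed.

Lemma polar1 x A : of_type x.1 A -> coef f [:: x] *: A = 0.
Proof.
move=> hA; rewrite -(@hpart_id 1 (dirac x A)) // => [|z]; last exact: dirac_type.
rewrite -hsum_mon; apply: eq_hsum => -[|a [|//]] // _.
by rewrite /= mulmx1 /dirac /mon eqseq_cons andbT.
Qed.

Lemma polar2 x y A B : of_type x.1 A -> of_type y.1 B ->
  coef f [:: x; y] *: (A *m B) + coef f [:: y; x] *: (B *m A) = 0.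
Proof.
move=> hA hB; pose D := dirac x A; pose D' := dirac y B.
have hD z : of_type z.1 (D z) by apply: dirac_type.
have hD' z : of_type z.1 (D' z) by apply: dirac_type.
have E e : admissible_eval e -> hsum 2 (eprod e) = 0 by apply: hpart_id.
(* The second difference keeps the products that use both A and B. *)
transitivity (hsum 2 (fun w =>
    eprod (fun z => D z + D' z) w - eprod D w - eprod D' w)); last first.
  by rewrite !hsumB !E ?subr0 // => z; apply: of_typeD.
rewrite -!hsum_mon -hsumD; apply: eq_hsum => -[|a [|b [|//]]] // _.
rewrite !mon_cons mon_nil !mulr1 /= !mulmx1 polarize2.
by rewrite /D /D' /dirac -!scalemxAl -!scalemxAr !scalerA.
Qed.

Lemma scale3 (a b c : F) A B C :
  (a *: A) *m ((b *: B) *m (c *: C)) = (a * (b * c)) *: (A *m B *m C).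
Proof. by rewrite -!scalemxAl -!scalemxAr !scalerA mulmxA. Qed.

Lemma polar3 x y z A B C : of_type x.1 A -> of_type y.1 B -> of_type z.1 C ->
  comb6 (coef f [:: x; y; z]) (coef f [:: x; z; y]) (coef f [:: y; x; z])
    (coef f [:: y; z; x]) (coef f [:: z; x; y]) (coef f [:: z; y; x]) A B C = 0.
Proof.
move=> hA hB hC; pose D1 := dirac x A; pose D2 := dirac y B; pose D3 := dirac z C.
have h1 t : of_type t.1 (D1 t) by apply: dirac_type.
have h2 t : of_type t.1 (D2 t) by apply: dirac_type.
have h3 t : of_type t.1 (D3 t) by apply: dirac_type.
have E e : admissible_eval e -> hsum 3 (eprod e) = 0 by apply: hpart_id.
(* The alternating sum of [polarize3], each term of which is an admissible evaluation. *)
transitivity (hsum 3 (fun w =>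
    eprod (fun t => D1 t + D2 t + D3 t) w - eprod (fun t => D1 t + D2 t) w
    - eprod (fun t => D1 t + D3 t) w - eprod (fun t => D2 t + D3 t) w
    + eprod D1 w + eprod D2 w + eprod D3 w)); last first.
  have h12 t := of_typeD (h1 t) (h2 t); have h13 t := of_typeD (h1 t) (h3 t).
  have h23 t := of_typeD (h2 t) (h3 t); have h123 t := of_typeD (h12 t) (h3 t).
  by do 3!rewrite hsumD; rewrite !hsumB !E ?subr0 ?addr0.
rewrite /comb6 -!hsum_mon -!hsumD; apply: eq_hsum => -[|a [|b [|c [|//]]]] // _.
rewrite !mon_cons mon_nil !mulr1 /= !mulmx1; apply/esym/(etrans (polarize3 _ _ _ _ _ _ _ _ _)).
by rewrite /D1 /D2 /D3 /dirac !scale3.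
Qed.

Lemma polar0 : coef f [::] = 0.
Proof.
have z0 : admissible_eval (fun=> 0 : 'M[F]_3).
  move=> x; apply: (of_type0 x.1).
have /matrixP/(_ 0 0) : coef f [::] *: (1%:M : 'M[F]_3) = 0.
  rewrite -hsum_mon -(@hpart_id 0 _ isT z0); apply: eq_hsum => -[|//] _.
  by rewrite /mon eqxx scale1r.
by rewrite !mxE eqxx mulr1.
Qed.

(** * Recovering f from its multilinear elements *)

Definition letters : seq var := undup (flatten (words_of f)).

Lemma coef_letters w x : x \in w -> x \notin letters -> coef f w = 0.
Proof.
move=> xw xN; apply: coef_words_of; apply: contra xN => wf.
by rewrite mem_undup; apply/flattenP; exists w.
Qed.

(** The condition covers letters that do not occur in f, whose words have coefficient 0. *)
Lemma sum_letters (g : var -> F) x : (x \notin letters -> g x = 0) ->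
  \sum_(y <- letters) g y * (x == y)%:R = g x.
Proof.
move=> gx; have [xV|xN] := boolP (x \in letters); last first.
  rewrite gx // big_seq big1 // => y yV; case: eqP => [xy|_]; last by rewrite mulr0.
  by rewrite xy yV in xN.
rewrite (bigD1_seq x) ?undup_uniq //= eqxx mulr1 big1 ?addr0 // => y.
by rewrite eq_sym => /negPf ->; rewrite mulr0.
Qed.

Lemma sum_letters1 w :
  \sum_(x <- letters) coef f [:: x] * mon [:: x] w = coef f w *+ (size w == 1).
Proof.
have [|sz] := eqVneq (size w) 1; last first.
  by apply: big1 => x _; rewrite mon_size ?mulr0.
case: w => [|a [|//]] // _; rewrite mulr1n.
rewrite -(@sum_letters (fun x => coef f [:: x])).
  by apply: eq_bigr => x _; rewrite mon_cons mon_nil mulr1.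
by apply: coef_letters; rewrite inE.
Qed.

Lemma sum_letters2 w :
  \sum_(x <- letters) \sum_(y <- letters) coef f [:: x; y] * mon [:: x; y] w
  = coef f w *+ (size w == 2).
Proof.
have [|sz] := eqVneq (size w) 2; last first.
  by apply: big1 => x _; apply: big1 => y _; rewrite mon_size ?mulr0.
case: w => [|a [|b [|//]]] // _; rewrite mulr1n.
rewrite -(@sum_letters (fun x => coef f [:: x; b])); last first.
  by apply: coef_letters; rewrite inE eqxx.
apply: eq_bigr => x _; rewrite -(@sum_letters (fun y => coef f [:: x; y])); last first.
  by apply: coef_letters; rewrite !inE eqxx orbT.
rewrite mulr_suml; apply: eq_bigr => y _.
by rewrite !mon_cons mon_nil; ring.
Qed.

Lemma sum_letters3 w :
  \sum_(x <- letters) \sum_(y <- letters) \sum_(z <- letters)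
    coef f [:: x; y; z] * mon [:: x; y; z] w
  = coef f w *+ (size w == 3).
Proof.
have [|sz] := eqVneq (size w) 3; last first.
  by apply: big1 => x _; apply: big1 => y _; apply: big1 => z _; rewrite mon_size ?mulr0.
case: w => [|a [|b [|c [|//]]]] // _; rewrite mulr1n.
rewrite -(@sum_letters (fun x => coef f [:: x; b; c])); last first.
  by apply: coef_letters; rewrite inE eqxx.
apply: eq_bigr => x _; rewrite -(@sum_letters (fun y => coef f [:: x; y; c])); last first.
  by apply: coef_letters; rewrite !inE eqxx orbT.
rewrite mulr_suml; apply: eq_bigr => y _.
rewrite -(@sum_letters (fun z => coef f [:: x; y; z])); last first.
  by apply: coef_letters; rewrite !inE eqxx !orbT.
rewrite !mulr_suml; apply: eq_bigr => z _.
by rewrite !mon_cons mon_nil; ring.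
Qed.

Lemma inT_degree1 : inT (fun w => coef f w *+ (size w == 1)).
Proof.
apply: inT_ext sum_letters1 _; apply: inT_sum => x.
(* The word x is treated as xyz with y = z = 1. *)
have V : vanishing (coef f [:: x]) 0 0 0 0 0 x.1 (false, false) (false, false).
  by move=> A B C hA _ _; rewrite /comb6 !scale0r !addr0 -!mulmxA scalemxAl polar1 ?mul0mx.
apply: (coef_in_TI (comb_term_in_TI V (var_ttype x) one_ttype one_ttype)) => w.
by rewrite coef_flat /= !big_cons big_nil /=; ring.
Qed.

Lemma inT_degree2 : inT (fun w => coef f w *+ (size w == 2)).
Proof.
have n2 : 2 != 0 :> F := natr_neq0 1.
(* Symmetrizing over (x, y) counts each word twice. *)
suff I : inT (fun w => \sum_(x <- letters) \sum_(y <- letters)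
    (coef f [:: x; y] * mon [:: x; y] w + coef f [:: y; x] * mon [:: y; x] w)).
  apply: inT_ext (inTZ 2^-1 I) => w.
  under eq_bigr do rewrite big_split /=.
  rewrite big_split /= [X in _ * (_ + X)]exchange_big /= !sum_letters2.
  by field.
apply: inT_sum => x; apply: inT_sum => y.
have V : vanishing (coef f [:: x; y]) 0 (coef f [:: y; x]) 0 0 0 x.1 y.1 (false, false).
  move=> A B C hA hB _; rewrite /comb6 !scale0r !addr0.
  rewrite (scalemxAl _ (A *m B)) (scalemxAl _ (B *m A)) -mulmxDl.
  by rewrite polar2 ?mul0mx.
apply: (coef_in_TI (comb_term_in_TI V (var_ttype x) (var_ttype y) one_ttype)) => w.
by rewrite coef_flat /= !big_cons big_nil /=; ring.
Qed.

Lemma inT_degree3 : inT (fun w => coef f w *+ (size w == 3)).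
Proof.
have n6 : 6 != 0 :> F := natr_neq0 5.
suff I : inT (fun w => \sum_(x <- letters) \sum_(y <- letters) \sum_(z <- letters)
    word6 (coef f [:: x; y; z]) (coef f [:: x; z; y]) (coef f [:: y; x; z])
      (coef f [:: y; z; x]) (coef f [:: z; x; y]) (coef f [:: z; y; x]) x y z w).
  apply: inT_ext (inTZ 6^-1 I) => w.
  under eq_bigr do under eq_bigr do rewrite /word6 !big_split /=.
  under eq_bigr do rewrite !big_split /=.
  rewrite !big_split /= sum_letters3.
  (* Renaming the summation variables by adjacent transpositions gives all six sums the same value,
     whence the factor 1/6. *)
  pose s (h : var -> var -> var -> F) :=
    \sum_(x <- letters) \sum_(y <- letters) \sum_(z <- letters) h x y z.
  pose g x y z := coef f [:: x; y; z] * mon [:: x; y; z] w.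
  have swap23 h : s (fun x y z => h x z y) = s h.
    by apply: eq_bigr => x _; apply: exchange_big.
  have swap12 h : s (fun x y z => h y x z) = s h by apply: exchange_big.
  have E1 : s g = coef f w *+ (size w == 3) := sum_letters3 w.
  have E2 := etrans (swap23 g) E1.
  have E3 := etrans (swap12 g) E1.
  have E4 := etrans (swap12 (fun x y z => g x z y)) E2.
  have E5 := etrans (swap23 (fun x y z => g y x z)) E3.
  have E6 := etrans (swap12 (fun x y z => g z x y)) E5.
  by move: E2 E3 E4 E5 E6; rewrite /s /g /= => -> -> -> -> ->; field.
apply: inT_sum => x; apply: inT_sum => y; apply: inT_sum => z.
by apply: solved_all => A B C; apply: polar3.
Qed.

Lemma identity_in_TI : in_TI (@calI F) f.
Proof.
have [p pI pE] := inTD (inTD inT_degree1 inT_degree2) inT_degree3.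
apply: TI_eq pI => w; rewrite pE.
(* Longer words have coefficient 0 by the degree bound, the empty word by [polar0]. *)
have [big_w|] := leqP 4 (size w).
  have [->|/f_deg] := eqVneq (coef f w) 0; first by rewrite !mul0rn !addr0.
  by rewrite leqNgt big_w.
case: w => [|a [|b [|c [|//]]]] _ /=; rewrite ?mulr0n ?mulr1n ?addr0 ?add0r //.
by rewrite polar0.
Qed.

End Identity.

End LowDegreeIdentities.

Theorem theorem4p8 (F : fieldType) (charF0 : [pchar F] =i pred0) (f : term F) :
  star_identity f -> degree_le f 3 -> in_TI (@calI F) f.
Proof. by move=> f_id f_deg; apply: identity_in_TI. Qed.
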